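(* Let $\gamma>0$, let $J,K$ be the symmetric pair of operators between $L^2(\mu)$ and $\mathcal H_E$, and let $\widetilde\Delta_{\mathcal H_E}=K^*K$ be the self-adjoint extension of $\Delta_{\mathcal H_E}$. For a given function $\psi\in L^2(\mu)$ put $$Q(h)=\|\psi-Kh\|_{L^2(\mu)}^2+\gamma\|h\|_{\mathcal H_E}^2 .$$ Then $$\mathrm{arg\,min}\{Q(h):h\in\mathcal H_E\}=(\gamma I+\widetilde\Delta_{\mathcal H_E})^{-1}J\psi .$$
   Context: Setting. $(V,\mathcal B)$ is an uncountable standard Borel space, $\mu$ a non-atomic $\sigma$-finite positive Borel measure on it. $\rho$ is a $\sigma$-finite positive measure on $(V\times V,\mathcal B\times\mathcal B)$ which is symmetric, $\rho(A\times B)=\rho(B\times A)$, and which disintegrates as $\rho(f)=\int_V\int_V f(x,y)\,d\rho_x(y)\,d\mu(x)$; $c(x):=\rho_x(V)$ satisfies $0<c<\infty$ $\mu$-a.e. and $\int_A c\,d\mu<\infty$ whenever $\mu(A)<\infty$. $\rho$ is irreducible: for the kernels $k^1(x,A)=\rho_x(A)$, $k^n(x,A)=\int k^{n-1}(y,A)\rho_x(dy)$, for every $A$ with $\mu(A)>0$ and $\mu$-a.e. $x$ there is $n$ with $k^n(x,A)>0$. $\mathcal H_E$ is the Hilbert space of Borel functions $f:V\to\mathbb R$ (modulo constants) with $\|f\|_{\mathcal H_E}^2=\frac12\iint(f(x)-f(y))^2\,d\rho(x,y)<\infty$; its elements are assumed to be in $L^2_{\mathrm{loc}}(\mu)$.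 $\Delta f(x)=\int_V(f(x)-f(y))\,d\rho_x(y)$, and $\Delta_{\mathcal H_E}$ is its realization as a symmetric operator in $\mathcal H_E$. The symmetric pair. $J:L^2(\mu)\to\mathcal H_E$ and $K:\mathcal H_E\to L^2(\mu)$ are densely defined operators with $\langle J\varphi,\psi\rangle_{\mathcal H_E}=\langle\varphi,K\psi\rangle_{L^2(\mu)}$ on dense subsets, and (after passing to closures) $J^*=K$, $K^*=J$. On $\mathrm{Span}\{\chi_A:\mu(A)<\infty\}$, $J$ sends $\varphi$ to its class in $\mathcal H_E$. The operator $K^*K=JJ^*$ is self-adjoint in $\mathcal H_E$ and extends $\Delta_{\mathcal H_E}$. Conventions: $Q(h)$ is considered for $h$ in the domain of $K$ (and is $+\infty$ otherwise); the operator $(\gamma I+\widetilde\Delta_{\mathcal H_E})^{-1}J=(\gamma I+JK)^{-1}J$ is bounded and is understood as a bounded operator defined on all of $L^2(\mu)$. *)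

(* Defs.v *)
From HB Require Import structures.
From mathcomp Require Import all_boot all_order all_algebra.
From mathcomp Require Import all_classical all_reals all_analysis.
From mathcomp Require Import measurable_realfun ring.
Set Implicit Arguments.
Unset Strict Implicit.
Unset Printing Implicit Defensive.
Import Order.TTheory GRing.Theory Num.Theory.
Import numFieldNormedType.Exports.
Local Open Scope classical_set_scope.
Local Open Scope ring_scope.
Local Open Scope quotient_scope.

Section LmodQuotient.
Context (K : pzRingType) (M : lmodType K) (I : submodClosed M).

Definition lideal : {pred M} := fun x => x \in I.

Lemma lideal_zmod : zmod_closed lideal.
Proof.
split=> [|x y xI yI]; first exact: (rpred0 I).
by apply: (rpredD (S := I)) => //; rewrite -scaleN1r; exact: (rpredZ (s := I)).
Qed.
HB.instance Definition _ := GRing.isZmodClosed.Build M lideal lideal_zmod.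

Definition lquot : Type := Quotient.quot lideal.
HB.instance Definition _ := Choice.on lquot.
HB.instance Definition _ := GRing.Zmodule.on lquot.

Definition lclass (x : M) : lquot := \pi_(Quotient.quot lideal) x.
Definition lrepr (u : lquot) : M := repr (u : Quotient.quot lideal).

Definition lquot_scale (a : K) (u : lquot) : lquot := lclass (a *: lrepr u).

Lemma lreprK u : lclass (lrepr u) = u.
Proof. exact: reprK. Qed.

Lemma lclass_eq x y : lclass x = lclass y <-> x - y \in I.
Proof.
rewrite -[x - y \in I]/(x - y \in lideal) Quotient.idealrBE.
by split => [/eqP//|/eqP].
Qed.

Lemma lclassD x y : lclass (x + y) = lclass x + lclass y.
Proof. exact: (@Quotient.pi_add M lideal). Qed.

Lemma lclassZ a x : lclass (a *: x) = lquot_scale a (lclass x).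
Proof.
by apply/lclass_eq; rewrite -scalerBr rpredZ//; apply/lclass_eq; rewrite lreprK.
Qed.

Lemma lquot_scaleA a b u :
  lquot_scale a (lquot_scale b u) = lquot_scale (a * b) u.
Proof. by rewrite -[u]lreprK -!lclassZ scalerA. Qed.

Lemma lquot_scale1 : left_id 1 lquot_scale.
Proof. by move=> u; rewrite -[u]lreprK -lclassZ scale1r. Qed.

Lemma lquot_scaleDr : right_distributive lquot_scale +%R.
Proof.
by move=> a u v; rewrite -[u]lreprK -[v]lreprK -lclassD -!lclassZ scalerDr lclassD.
Qed.

Lemma lquot_scaleDl u : {morph lquot_scale^~ u : a b / a + b}.
Proof. by move=> a b; rewrite -[u]lreprK -!lclassZ scalerDl lclassD. Qed.

HB.instance Definition _ := GRing.Zmodule_isLmodule.Build K lquot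
  lquot_scaleA lquot_scale1 lquot_scaleDr lquot_scaleDl.

End LmodQuotient.

(* A possibly unbounded operator from E to F is given by its graph, a set of
   pairs (x, T x); inner products are passed as explicit functions. *)
Section Operators.
Context (R : realType).
Implicit Types E F G : lmodType R.

Definition sqnorm E (ip : E -> E -> R) (x : E) : R := ip x x.

Definition dense_subset E (ip : E -> E -> R) (D : set E) : Prop :=
  forall x (e : R), 0 < e -> exists2 y, D y & sqnorm ip (x - y) < e.

Definition cauchy_complete E (ip : E -> E -> R) : Prop :=
  forall u : nat -> E,
    (forall e : R, 0 < e -> exists N, forall m n,
      (N <= m)%N -> (N <= n)%N -> sqnorm ip (u m - u n) < e) ->
    exists x, (fun n => sqnorm ip (u n - x)) @ \oo --> (0 : R).

Definition dom E F (T : set (E * F)) : set E := [set x | exists y, T (x, y)].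

Definition linear_operator E F (T : set (E * F)) : Prop :=
  [/\ T (0, 0),
      forall (a : R) x x' y y', T (x, y) -> T (x', y') ->
        T (a *: x + x', a *: y + y')
    & forall x y y', T (x, y) -> T (x, y') -> y = y'].

(* The value of T at x; it is 0 when x is outside the domain of T. *)
Definition opval E F (T : set (E * F)) (x : E) : F := xget 0 [set y | T (x, y)].

Definition adjoint E F (ipE : E -> E -> R) (ipF : F -> F -> R)
    (T : set (E * F)) : set (F * E) :=
  [set p | forall x y, T (x, y) -> ipF y p.1 = ipE x p.2].

Definition symmetric_operator E (ip : E -> E -> R) (T : set (E * E)) : Prop :=
  linear_operator T /\
  forall x y x' y', T (x, y) -> T (x', y') -> ip y x' = ip x y'.

Definition op_comp E F G (S : set (F * G)) (T : set (E * F)) : set (E * G) :=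
  [set p | exists2 y, T (p.1, y) & S (y, p.2)].

Definition op_inv E F (T : set (E * F)) : set (F * E) := [set p | T (p.2, p.1)].

(* c I + T *)
Definition op_shift E (c : R) (T : set (E * E)) : set (E * E) :=
  [set p | exists2 y, T (p.1, y) & p.2 = c *: p.1 + y].

Definition bounded_operator E F (ipE : E -> E -> R) (ipF : F -> F -> R)
    (B : E -> F) : Prop :=
  linear B /\ exists C : R, forall x, sqnorm ipF (B x) <= C * sqnorm ipE x.

Definition restriction E F (B : E -> F) (D : set E) : set (E * F) :=
  [set p | D p.1 /\ p.2 = B p.1].

Definition symmetric_pair E F (ipE : E -> E -> R) (ipF : F -> F -> R)
    (J : set (E * F)) (K : set (F * E)) : Prop :=
  [/\ linear_operator J /\ linear_operator K,
      dense_subset ipE (dom J) /\ dense_subset ipF (dom K),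
      forall x y u v, J (x, y) -> K (u, v) -> ipF y u = ipE x v,
      adjoint ipE ipF J = K & adjoint ipF ipE K = J].

Definition argmin (T : Type) (Q : T -> \bar R) : set T :=
  [set h | forall h', (Q h <= Q h')%E].

End Operators.

Section MeasureSpace.
Context (R : realType) (d : measure_display) (V : measurableType d).

(* (V, B) is Borel isomorphic to a Polish space. *)
Definition standard_borel : Prop :=
  exists (P : completePseudoMetricType R) (f : V -> P),
    [/\ hausdorff_space P, @second_countable P, bijective f &
        forall A : set V, measurable A <-> <<s open >> (f @` A)].

Context (mu : {measure set V -> \bar R}).
Context (rho : {measure set (V * V) -> \bar R}) (rhox : R.-ker V ~> V).

Definition non_atomic : Prop :=
  forall A, measurable A -> (0 < mu A)%E ->
    exists B, [/\ measurable B, B `<=` A, (0 < mu B)%E & (mu B < mu A)%E].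

Definition symmetric_measure : Prop :=
  forall A B, measurable A -> measurable B -> rho (A `*` B) = rho (B `*` A).

Definition disintegration : Prop :=
  forall f : V * V -> \bar R, measurable_fun [set: V * V] f ->
    (forall p, 0 <= f p)%E ->
    (\int[rho]_p f p = \int[mu]_x \int[rhox x]_y f (x, y))%E.

Definition total_conductance (x : V) : \bar R := rhox x [set: V].

(* kernel_pow n is the kernel k^{n+1}. *)
Fixpoint kernel_pow (n : nat) (x : V) (A : set V) : \bar R :=
  if n is m.+1 then (\int[rhox x]_y kernel_pow m y A)%E else rhox x A.

Definition irreducible_kernel : Prop :=
  forall A, measurable A -> (0 < mu A)%E ->
    {ae mu, forall x, exists n, (0 < kernel_pow n x A)%E}.

Definition L2_loc (f : V -> R) : Prop :=
  measurable_fun [set: V] f /\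
  forall A, measurable A -> (mu A < +oo)%E ->
    (\int[mu]_(x in A) ((f x) ^+ 2)%:E < +oo)%E.

Definition laplacian (f : V -> R) (x : V) : R := \int[rhox x]_y (f x - f y).

(* Span of the indicator functions of sets of finite measure. *)
Definition simple_span : set (V -> R) :=
  [set f | exists (n : nat) (c : 'I_n -> R) (A : 'I_n -> set V),
    (forall i, measurable (A i) /\ (mu (A i) < +oo)%E) /\
    f = (fun x => \sum_(i < n) c i * \1_(A i) x)].

End MeasureSpace.

Section L2Space.
Context (R : realType) (d : measure_display) (V : measurableType d).
Context (mu : {measure set V -> \bar R}).

Definition L2fun := LfunType mu (lee1n 2).
HB.instance Definition _ := GRing.Lmodule.on L2fun.

Definition ae_zero : {pred L2fun} :=
  mem [set f : L2fun | {ae mu, forall x, f x = 0}].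

Lemma ae_zero_submod : submod_closed ae_zero.
Proof.
split; first by rewrite inE; apply: aeW => x.
move=> a f g; rewrite !inE /= => f0 g0.
by apply: filterS2 f0 g0 => x fx gx; rewrite /= !fctE fx gx scaler0 addr0.
Qed.
HB.instance Definition _ := GRing.isSubmodClosed.Build R L2fun ae_zero
  ae_zero_submod.

Definition L2 : lmodType R := lquot ae_zero.

Definition L2class (f : L2fun) : L2 := lclass ae_zero f.

Definition L2ip (u v : L2) : R :=
  \int[mu]_x ((lrepr u : L2fun) x * (lrepr v : L2fun) x).

End L2Space.
Arguments L2ip {R d V} mu u v.

Section EnergySpace.
Context (R : realType) (d : measure_display) (V : measurableType d).
Context (mu : {measure set V -> \bar R}) (rho : {measure set (V * V) -> \bar R}).

Definition energy (f : V -> R) : \bar R :=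
  (2^-1%:E * \int[rho]_p ((f p.1 - f p.2) ^+ 2)%:E)%E.

Definition finite_energy : {pred V -> R} :=
  mem [set f : V -> R | measurable_fun [set: V] f /\ (energy f < +oo)%E].

Lemma finite_energy_submod : submod_closed finite_energy.
Proof.
have mE (f : V -> R) : measurable_fun setT f ->
    measurable_fun [set: V * V] (fun p => ((f p.1 - f p.2) ^+ 2)%:E).
  move=> mf; apply/measurable_EFinP; apply: measurable_funX.
  by apply: measurable_funB;
    [exact: (measurableT_comp mf measurable_fst)
    |exact: (measurableT_comp mf measurable_snd)].
have fin (f : V -> R) : (energy f < +oo)%E <->
    (\int[rho]_p ((f p.1 - f p.2) ^+ 2)%:E < +oo)%E.
  have i0 : (0 <= \int[rho]_p ((f p.1 - f p.2) ^+ 2)%:E)%E.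
    by apply: integral_ge0 => p _; rewrite lee_fin sqr_ge0.
  rewrite /energy; move: i0; case: (integral _ _ _) => [r||] //= _.
    by rewrite -EFinM !ltry.
  by rewrite gt0_muley ?lte_fin ?invr_gt0.
split.
  rewrite inE; split; first exact: measurable_cst.
  by apply/fin; under eq_integral do rewrite subr0 expr0n; rewrite integral0.
move=> a f g; rewrite !inE => -[mf /fin ff] [mg /fin fg].
have mfg : measurable_fun setT (a *: f + g).
  by apply: measurable_funD => //; exact: measurable_funM.
split=> //; apply/fin.
set F := fun p : V * V => ((f p.1 - f p.2) ^+ 2)%:E.
set G := fun p : V * V => ((g p.1 - g p.2) ^+ 2)%:E.
have F0 p : (0 <= F p)%E by rewrite lee_fin sqr_ge0.
have G0 p : (0 <= G p)%E by rewrite lee_fin sqr_ge0.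
have c0 : (0 <= (2 * a ^+ 2)%:E :> \bar R)%E.
  by rewrite lee_fin mulr_ge0 ?sqr_ge0.
have mF : measurable_fun [set: V * V] F by exact: mE.
have mG : measurable_fun [set: V * V] G by exact: mE.
apply: (@le_lt_trans _ _
    (\int[rho]_p ((2 * a ^+ 2)%:E * F p + 2%:E * G p))%E).
  apply: (@ge0_le_integral _ _ R rho setT measurableT).
  - by move=> p _; rewrite lee_fin sqr_ge0.
  - exact: mE.
  - by apply: emeasurable_funD; exact: measurable_funeM.
  - move=> p _; rewrite /F /G -!EFinM -EFinD lee_fin /= !fctE.
    set x := f p.1 - f p.2; set y := g p.1 - g p.2.
    have -> : a *: f p.1 + g p.1 - (a *: f p.2 + g p.2) = a * x + y.
      by rewrite /x /y /GRing.scale /= mulrBr addrACA opprD.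
    rewrite -subr_ge0.
    have -> : 2 * a ^+ 2 * x ^+ 2 + 2 * y ^+ 2 - (a * x + y) ^+ 2 =
        (a * x - y) ^+ 2.
      by ring.
    exact: sqr_ge0.
rewrite ge0_integralD //.
- rewrite !ge0_integralZl //.
  by rewrite lte_add_pinfty // lte_mul_pinfty.
- by move=> p _; rewrite mule_ge0.
- exact: measurable_funeM.
- by move=> p _; rewrite mule_ge0.
- exact: measurable_funeM.
Qed.
HB.instance Definition _ := GRing.isSubmodClosed.Build R (V -> R) finite_energy
  finite_energy_submod.

Record energy_fun := EnergyFun {
  energy_fun_val :> V -> R;
  energy_funP : energy_fun_val \in finite_energy
}.
HB.instance Definition _ := [isSub for energy_fun_val].
HB.instance Definition _ := [Choice of energy_fun by <:].
HB.instance Definition _ := [SubChoice_isSubLmodule of energy_fun by <:].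

Definition ae_const : {pred energy_fun} :=
  mem [set f : energy_fun | exists c : R, {ae mu, forall x, f x = c}].

Lemma ae_const_submod : submod_closed ae_const.
Proof.
split; first by rewrite inE; exists 0; apply: aeW => x.
move=> a f g; rewrite !inE /= => -[c fc] [e ge]; exists (a * c + e).
by apply: filterS2 fc ge => x fx gx; rewrite -fx -gx.
Qed.
HB.instance Definition _ := GRing.isSubmodClosed.Build R energy_fun ae_const
  ae_const_submod.

(* Finite energy functions modulo constants; as usual, functions that agree
   mu-almost everywhere are identified. *)
Definition HE : lmodType R := lquot ae_const.

Definition HEclass (f : energy_fun) : HE := lclass ae_const f.

(* The polarization of the norm ||f||^2 = energy f. *)
Definition HEip (u v : HE) : R :=
  2^-1 * \int[rho]_p
    (((lrepr u : energy_fun) p.1 - (lrepr u : energy_fun) p.2) *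
     ((lrepr v : energy_fun) p.1 - (lrepr v : energy_fun) p.2)).

End EnergySpace.
Arguments HEip {R d V} mu rho u v.

Section GraphSetting.
Context (R : realType) (d : measure_display) (V : measurableType d).
Context (mu : {measure set V -> \bar R}) (rho : {measure set (V * V) -> \bar R}).
Context (rhox : R.-ker V ~> V).

(* phi |-> [phi] on Span {chi_A : mu A < +oo}. *)
Definition span_embedding : set (L2 mu * HE mu rho) :=
  [set p | exists (phi : L2fun mu) (f : energy_fun rho),
    [/\ simple_span mu phi, (phi : V -> R) = f &
        p = (L2class phi, HEclass mu f)]].

(* T acts as the pointwise Laplacian f |-> Delta f. *)
Definition realizes_laplacian (T : set (HE mu rho * HE mu rho)) : Prop :=
  forall u v, T (u, v) -> exists f g : energy_fun rho,
    [/\ u = HEclass mu f, v = HEclass mu g &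
        {ae mu, forall x, g x = laplacian rhox f x}].

(* Q h = ||psi - K h||^2 + gamma ||h||^2 on the domain of K, +oo elsewhere. *)
Definition Qfun (gamma : R) (K : set (HE mu rho * L2 mu)) (psi : L2 mu)
    (h : HE mu rho) : \bar R :=
  if `[< dom K h >] then
    (sqnorm (L2ip mu) (psi - opval K h) +
     gamma * sqnorm (HEip mu rho) h)%:E
  else +oo%E.

End GraphSetting.
Arguments span_embedding {R d V} mu rho.

(* Main.v *)
(** Give HE x L2 the inner product gamma <h, h'> + <v, v'>.  The graph of
    K = J^* is a closed subspace, so (0, psi) has a projection (h, K h) onto
    it, and by Pythagoras h is the unique minimizer of Q.  Orthogonality of
    the residual to the graph says that (psi - K h, gamma h) lies in the graph
    of K^* = J, i.e. J (psi - K h) = gamma h, and for psi in the domain of J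
    this is (gamma I + J K) h = J psi.

    The argument needs two concrete inputs.  L2 is complete (Riesz-Fischer).
    The energy form is definite modulo constants: if f(x) = f(y) rho-a.e., then
    for B = {f >= c} no kernel k^n charges B from the complement of B, so
    irreducibility makes B or its complement null for every c, and f is a.e.
    constant. *)

Require Import Defs.
From HB Require Import structures.
From mathcomp Require Import all_boot all_order all_algebra.
From mathcomp Require Import all_classical all_reals all_analysis.
From mathcomp Require Import measurable_realfun ring lra.
Set Implicit Arguments.
Unset Strict Implicit.
Unset Printing Implicit Defensive.
Import Order.TTheory GRing.Theory Num.Theory.
Import numFieldNormedType.Exports.
Local Open Scope classical_set_scope.
Local Open Scope ring_scope.

(** * Inner products and the minimization problem *)

Definition inner_product (R : realType) (E : lmodType R) (ip : E -> E -> R) :=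
  [/\ forall x y, ip x y = ip y x,
      forall a x y z, ip (a *: x + y) z = a * ip x z + ip y z,
      forall x, 0 <= ip x x
    & forall x, ip x x = 0 -> x = 0].

Section InnerProduct.
Context (R : realType).

(** A quadratic in [a] that is never negative has nonpositive discriminant: evaluate it at its
    vertex [b / c]. Besides Cauchy-Schwarz, this serves for approximate minimizers in [projection],
    where [e] is the error. *)
Lemma discriminant_le (e b c : R) : 0 <= c ->
  (forall a, 0 <= e - 2 * a * b + a ^+ 2 * c) -> b ^+ 2 <= e * c.
Proof.
rewrite le_eqVlt => /predU1P[<-|c0] h.
  have [->|b0] := eqVneq b 0; first by rewrite expr0n mulr0.
  (* For [c = 0] and [b != 0] the expression is affine in [a], and this point gives it the value
     -1. *)
  have := h ((e + 1) / (2 * b)).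
  have -> : 2 * ((e + 1) / (2 * b)) * b = e + 1 by field.
  by rewrite !mulr0 addr0; lra.
have := h (b / c).
have -> : e - 2 * (b / c) * b + (b / c) ^+ 2 * c = (e * c - b ^+ 2) / c.
  by field; rewrite gt_eqF.
by rewrite pmulr_lge0 ?invr_gt0// subr_ge0.
Qed.

Lemma le0_of_cvg0 (b : R) (v : nat -> R) :
  (forall n, b <= v n) -> v @ \oo --> (0 : R) -> b <= 0.
Proof.
move=> bv v0; rewrite -(cvg_lim _ v0)//; apply: limr_ge.
  by apply/cvg_ex; exists 0.
by apply: nearW.
Qed.

Context (E : lmodType R) (ip : E -> E -> R) (ipP : inner_product ip).
Local Notation sq := (sqnorm ip).

Lemma ipC x y : ip x y = ip y x. Proof. by case: ipP. Qed.
Lemma ipDZl a x y z : ip (a *: x + y) z = a * ip x z + ip y z.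
Proof. by case: ipP. Qed.
Lemma sqnorm_ge0 x : 0 <= sq x. Proof. by case: ipP => ? ? + _; exact. Qed.
Lemma sqnorm_eq0 x : sq x = 0 -> x = 0. Proof. by case: ipP => ? ? ?; exact. Qed.
Lemma ipDl x y z : ip (x + y) z = ip x z + ip y z.
Proof. by rewrite -[x]scale1r ipDZl mul1r scale1r. Qed.
Lemma ip0l z : ip 0 z = 0.
Proof. by have := ipDl 0 0 z; rewrite addr0; lra. Qed.
Lemma ipZl a x z : ip (a *: x) z = a * ip x z.
Proof. by rewrite -[a *: x]addr0 ipDZl ip0l addr0. Qed.
Lemma ipNl x z : ip (- x) z = - ip x z.
Proof. by rewrite -scaleN1r ipZl mulN1r. Qed.
Lemma ipBl x y z : ip (x - y) z = ip x z - ip y z.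
Proof. by rewrite ipDl ipNl. Qed.
Lemma ipDr x y z : ip x (y + z) = ip x y + ip x z.
Proof. by rewrite ipC ipDl !(ipC _ x). Qed.
Lemma ipZr a x y : ip x (a *: y) = a * ip x y.
Proof. by rewrite ipC ipZl ipC. Qed.
Lemma ipNr x y : ip x (- y) = - ip x y.
Proof. by rewrite ipC ipNl ipC. Qed.
Lemma ipBr x y z : ip x (y - z) = ip x y - ip x z.
Proof. by rewrite ipDr ipNr. Qed.

Lemma sqnormB x y : sq (x - y) = sq x - 2 * ip x y + sq y.
Proof. by rewrite /sqnorm ipBl !ipBr (ipC y x); ring. Qed.

Lemma sqnormZ a x : sq (a *: x) = a ^+ 2 * sq x.
Proof. by rewrite /sqnorm ipZl ipZr; ring. Qed.

Lemma sqnorm_subC x y : sq (x - y) = sq (y - x).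
Proof. by rewrite !sqnormB (ipC y x); ring. Qed.

Lemma cauchy_schwarz x y : ip x y ^+ 2 <= sq x * sq y.
Proof.
apply: discriminant_le => [|a]; first exact: sqnorm_ge0.
have := sqnorm_ge0 (x - a *: y); rewrite sqnormB sqnormZ ipZr.
by rewrite -!mulrA.
Qed.

(** The parallelogram law makes a minimizing sequence Cauchy. Orthogonality is proved approximately
    for its terms and then passed to the limit, so the limit need not first be shown to attain the
    infimum. *)
Lemma projection (S : set E) : cauchy_complete ip -> S 0 ->
  (forall a x y, S x -> S y -> S (a *: x + y)) ->
  (forall (u : nat -> E) x, (forall n, S (u n)) ->
     (fun n => sq (u n - x)) @ \oo --> (0 : R) -> S x) ->
  forall x, exists2 s, S s & forall t, S t -> ip (x - s) t = 0.
Proof.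
move=> cE S0 Slin Scl x.
pose D := [set sq (x - s) | s in S]; pose m := inf D.
have lbD : has_lbound D by exists 0 => _ [s _ <-]; exact: sqnorm_ge0.
have hD : has_inf D by split => //; exists (sq (x - 0)), 0.
have mle s : S s -> m <= sq (x - s) by move=> Ss; apply: ge_inf => //; exists s.
have /choice[s sP] (n : nat) :
    exists s, S s /\ sq (x - s) < m + harmonic n.
  have [|_ [s Ss <-] hs] := @inf_adherent _ D (harmonic n) _ hD.
    exact: harmonic_gt0.
  by exists s.
have SZ a y : S y -> S (a *: y) by move=> Sy; rewrite -[_ *: _]addr0; exact: Slin.
have parallelogram y z :
    sq (y - z) = 2 * sq (x - y) + 2 * sq (x - z) -
      4 * sq (x - 2^-1 *: (y + z)).
  by rewrite !sqnormB sqnormZ /sqnorm ipZr !ipDl !ipDr (ipC z y); field.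
have caus i j : sq (s i - s j) < 2 * harmonic i + 2 * harmonic j.
  have [[Si hi] [Sj hj]] := (sP i, sP j).
  (* The midpoint stays in [S], so the term subtracted in the parallelogram law is at least [4 * m]
     and absorbs the two infima. *)
  have : m <= sq (x - 2^-1 *: (s i + s j)).
    by apply/mle/SZ; rewrite -[s i]scale1r; exact: Slin.
  by rewrite (parallelogram (s i)); lra.
have [|y yP] := cE s.
  move=> e e0; have e4 : 0 < e / 4 by rewrite divr_gt0.
  have [N _ hN] := near_infty_natSinv_lt (PosNum e4).
  exists N => i j Ni Nj; have := caus i j.
  have : harmonic i < e / 4 by exact: hN.
  have : harmonic j < e / 4 by exact: hN.
  by lra.
have Sy : S y by apply: (Scl s) => // n; case: (sP n).
exists y => // t St.
apply/eqP; rewrite -sqrf_eq0 eq_le sqr_ge0 andbT.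
apply: (@le0_of_cvg0 _
  (fun n => 2 * sq t * (harmonic n + sq (s n - y)))); last first.
  rewrite -[X in _ --> X](mulr0 (2 * sq t)); apply: cvgMr.
  by rewrite -[X in _ --> X](addr0 0); apply: cvgD => //; exact: cvg_harmonic.
move=> n; have [Sn sn] := sP n.
(* Moving from [s n] along [t] stays in [S] and can lower the squared distance by at most
   [harmonic n], for every step length [a]. *)
have h1 : ip (x - s n) t ^+ 2 <= harmonic n * sq t.
  apply: discriminant_le => [|a]; first exact: sqnorm_ge0.
  have := mle (s n + a *: t).
  have -> : x - (s n + a *: t) = x - s n - a *: t by rewrite opprD addrA.
  rewrite sqnormB sqnormZ ipZr => h.
  have : S (s n + a *: t) by rewrite addrC; exact: Slin.
  by move/h; lra.
have h2 := cauchy_schwarz (s n - y) t.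
have -> : x - y = (x - s n) + (s n - y) by rewrite addrA subrK.
rewrite ipDl; move: (ip _ _) (ip (s n - y) t) h1 h2 => p q h1 h2.
have := sqr_ge0 (p - q).
by nra.
Qed.

End InnerProduct.

(** * Tikhonov regularization for an abstract symmetric pair *)

Section Tikhonov.
Context (R : realType) (E F : lmodType R).
Context (ipE : E -> E -> R) (ipF : F -> F -> R).
Context (ipEP : inner_product ipE) (ipFP : inner_product ipF).
Context (cE : cauchy_complete ipE) (cF : cauchy_complete ipF).

Definition graph_ip (g : R) (p q : F * E) : R :=
  g * ipF p.1 q.1 + ipE p.2 q.2.

Lemma graph_ip_inner_product g : 0 < g -> inner_product (graph_ip g).
Proof.
move=> g0; split.
- by move=> p q; rewrite /graph_ip (ipC ipEP) (ipC ipFP).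
- by move=> a p q r; rewrite /graph_ip /= (ipDZl ipEP) (ipDZl ipFP); ring.
- move=> p; apply: addr_ge0; last exact: (sqnorm_ge0 ipEP).
  by apply: mulr_ge0; [exact: ltW|exact: (sqnorm_ge0 ipFP)].
- move=> [x y] /eqP; rewrite /graph_ip /= paddr_eq0; last 2 first.
  + by apply: mulr_ge0; [exact: ltW|exact: (sqnorm_ge0 ipFP)].
  + exact: (sqnorm_ge0 ipEP).
  rewrite mulf_eq0 (gt_eqF g0) /=.
  by move=> /andP[/eqP/(sqnorm_eq0 ipFP) -> /eqP/(sqnorm_eq0 ipEP) ->].
Qed.

Lemma graph_ip_complete g : 0 < g -> cauchy_complete (graph_ip g).
Proof.
move=> g0 u cu.
have sqE m n : sqnorm (graph_ip g) (u m - u n) =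
    g * sqnorm ipF ((u m).1 - (u n).1) + sqnorm ipE ((u m).2 - (u n).2) by [].
have [|x hx] := cF (u := fst \o u).
  move=> e e0; have [N hN] := cu _ (mulr_gt0 g0 e0).
  exists N => m n Nm Nn; have := hN m n Nm Nn; rewrite sqE.
  have := sqnorm_ge0 ipEP ((u m).2 - (u n).2) => /= h1 h2.
  by rewrite -(ltr_pM2l g0); lra.
have [|y hy] := cE (u := snd \o u).
  move=> e e0; have [N hN] := cu _ e0.
  exists N => m n Nm Nn; have := hN m n Nm Nn; rewrite sqE.
  have := mulr_ge0 (ltW g0) (sqnorm_ge0 ipFP ((u m).1 - (u n).1)) => /=; lra.
exists (x, y).
rewrite -[X in _ --> X](addr0 0) -[X in _ --> X + _](mulr0 g).
by apply: cvgD => //; exact: cvgMr.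
Qed.

(** The graph of an adjoint is cut out by equations [ipF y p.1 = ipE x p.2], each continuous in [p]
    by Cauchy-Schwarz. *)
Lemma adjoint_closed (J : set (E * F)) (g : R) (u : nat -> F * E) (p : F * E) :
  0 < g -> (forall n, adjoint ipE ipF J (u n)) ->
  (fun n => sqnorm (graph_ip g) (u n - p)) @ \oo --> (0 : R) ->
  adjoint ipE ipF J p.
Proof.
move=> g0 Ju up x y Jxy.
apply/eqP; rewrite -subr_eq0 -sqrf_eq0 eq_le sqr_ge0 andbT.
(* The constant comes from [(s - t)^2 <= 2 s^2 + 2 t^2] and Cauchy-Schwarz in each factor; dividing
   by [g] undoes the weight in [graph_ip]. *)
pose C := 2 * (sqnorm ipF y / g + sqnorm ipE x).
apply: (@le0_of_cvg0 _ _ (fun n => C * sqnorm (graph_ip g) (u n - p))).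
  move=> n.
  rewrite -[sqnorm (graph_ip g) _]/(g * sqnorm ipF ((u n).1 - p.1) +
    sqnorm ipE ((u n).2 - p.2)) /C.
  have -> : ipF y p.1 - ipE x p.2 =
      ipE x ((u n).2 - p.2) - ipF y ((u n).1 - p.1).
    by rewrite (ipBr ipFP) (ipBr ipEP) (Ju n x y Jxy); ring.
  have hF := cauchy_schwarz ipFP y ((u n).1 - p.1).
  have hE := cauchy_schwarz ipEP x ((u n).2 - p.2).
  have := sqnorm_ge0 ipFP y; have := sqnorm_ge0 ipEP x.
  have := sqnorm_ge0 ipFP ((u n).1 - p.1).
  have := sqnorm_ge0 ipEP ((u n).2 - p.2).
  move: (sqnorm ipE ((u n).2 - p.2)) (sqnorm ipF ((u n).1 - p.1)) hF hE.
  move: (sqnorm ipE x) (sqnorm ipF y) => a b c e.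
  move: (ipE _ _) (ipF _ _) => s t hF hE c0 e0 a0 b0.
  have H1 := sqr_ge0 (s + t).
  have H2 : 0 <= b / g * c by rewrite mulr_ge0// divr_ge0// ltW.
  have H3 : 0 <= a * (g * e) by rewrite !mulr_ge0// ltW.
  have -> : 2 * (b / g + a) * (g * e + c) =
      2 * (b * e) + 2 * (a * c) + 2 * (b / g * c) + 2 * (a * (g * e)).
    by field; rewrite gt_eqF.
  by nra.
by rewrite -[X in _ --> X](mulr0 C); exact: cvgMr.
Qed.

Context (J : set (E * F)) (K : set (F * E)).
Context (JK : symmetric_pair ipE ipF J K).

Lemma opvalE (x : F) y : K (x, y) -> opval K x = y.
Proof.
move=> Kxy; rewrite /opval; case: xgetP => [_ -> Kxz|/(_ y)//].
by case: JK => -[_ [_ _ Kfun]] _ _ _ _; exact: Kfun Kxz Kxy.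
Qed.

Context (g : R) (g0 : 0 < g).

(* h solves (g I + JK) h = J psi in the weak sense, with v = K h. *)
Definition normal_equation (psi : E) (h : F) (v : E) : Prop :=
  K (h, v) /\ J (psi - v, g *: h).

(** Since [J] is the adjoint of [K], membership in [J] is tested against the graph of [K]. The test
    says that the residual [(- h, psi - v)] is [graph_ip g]-orthogonal to that graph, which is what
    [projection] delivers, for every [psi]. *)
Lemma normal_equationP psi h v : normal_equation psi h v <->
  K (h, v) /\ forall t w, K (t, w) -> ipE (psi - v) w = g * ipF h t.
Proof.
have [_ _ _ _ adjK] := JK.
split=> -[Kh].
  rewrite -adjK => JP; split=> // t w Ktw.
  have := JP _ _ Ktw => /=.
  by rewrite (ipC ipEP) => ->; rewrite (ipZr ipFP) (ipC ipFP).
move=> hP; split => //; rewrite -adjK => t w Ktw /=.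
by rewrite (ipC ipEP) (hP _ _ Ktw) (ipZr ipFP) (ipC ipFP).
Qed.

Lemma normal_equation_ex psi : exists h v, normal_equation psi h v.
Proof.
have [[_ [K0 Klin _]] _ _ adjJ _] := JK.
have [||||[h v] Khv hP] := projection (graph_ip_inner_product g0) (S := K) _ _ _ _
  (0, psi).
- exact: graph_ip_complete.
- exact: K0.
- by move=> a [x y] [x' y']; exact: Klin.
- by move=> u p Ku up; rewrite -adjJ; apply: adjoint_closed up => // n; rewrite adjJ.
exists h, v; apply/normal_equationP; split=> // t w Ktw.
have := hP _ Ktw; rewrite /graph_ip /= sub0r (ipNl ipFP).
by move=> /eqP; rewrite mulrN addrC subr_eq0 => /eqP.
Qed.

Definition objective psi (h : F) (v : E) : R :=
  sqnorm ipE (psi - v) + g * sqnorm ipF h.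

(** Pythagoras: the cross terms cancel by the normal equation tested on [(h', v')] and [(h, v)].
    Minimality, uniqueness and the norm bound all follow from this identity. *)
Lemma objectiveE psi h v h' v' : normal_equation psi h v -> K (h', v') ->
  objective psi h' v' =
    objective psi h v + sqnorm ipE (v' - v) + g * sqnorm ipF (h' - h).
Proof.
move=> /normal_equationP[Khv hP] Kh'.
have e1 := hP _ _ Kh'; have e2 := hP _ _ Khv.
rewrite /objective.
have -> : psi - v' = (psi - v) - (v' - v) by rewrite opprB addrA subrK.
rewrite (sqnormB ipEP (psi - v)) (sqnormB ipFP h') (ipBr ipEP) e1 e2 (ipC ipFP h').
by rewrite /sqnorm; ring.
Qed.

Lemma normal_equation_uniq psi h v h' v' :
  normal_equation psi h v -> normal_equation psi h' v' -> h' = h.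
Proof.
move=> Ph Ph'.
(* Each solution is compared with the other; in the sum of the two identities the objective values
   cancel and only squares remain. *)
have [/objectiveE-/(_ _ _ Ph.1) e1 /objectiveE-/(_ _ _ Ph'.1) e2] := (Ph', Ph).
have := sqnorm_ge0 ipEP (v' - v); have := sqnorm_ge0 ipEP (v - v').
have hh := sqnorm_ge0 ipFP (h - h').
move: e1 e2; rewrite (sqnorm_subC ipFP h') => e1 e2 ? ?.
have : g * sqnorm ipF (h - h') = 0.
  by have := mulr_ge0 (ltW g0) hh; lra.
move=> /eqP; rewrite mulf_eq0 (gt_eqF g0) /= => /eqP/(sqnorm_eq0 ipFP)/eqP.
by rewrite subr_eq0 => /eqP.
Qed.

Lemma normal_equation_linear a psi h v psi' h' v' :
  normal_equation psi h v -> normal_equation psi' h' v' ->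
  normal_equation (a *: psi + psi') (a *: h + h') (a *: v + v').
Proof.
have [[[_ Jlin _] [_ Klin _]] _ _ _ _] := JK.
move=> [K1 J1] [K2 J2]; split; first exact: Klin.
have -> : a *: psi + psi' - (a *: v + v') = a *: (psi - v) + (psi' - v').
  by rewrite scalerBr opprD addrACA.
have -> : g *: (a *: h + h') = a *: (g *: h) + g *: h'.
  by rewrite scalerDr !scalerA (mulrC a).
exact: Jlin.
Qed.

(** The solution is compared with the competitor 0, whose objective is the squared norm of [psi]. *)
Lemma normal_equation_bound psi h v : normal_equation psi h v ->
  sqnorm ipF h <= g^-1 * sqnorm ipE psi.
Proof.
have [[_ [K0 _ _]] _ _ _ _] := JK.
move=> /objectiveE/(_ K0); rewrite /objective subr0.
rewrite {2}/sqnorm (ip0l ipFP) mulr0 addr0 => e.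
rewrite ler_pdivlMl// e; have := sqnorm_ge0 ipEP (psi - v).
have := sqnorm_ge0 ipEP (0 - v).
by have := mulr_ge0 (ltW g0) (sqnorm_ge0 ipFP (0 - h)); lra.
Qed.

(** When [J psi] exists, [J (psi - v) = g *: h] splits by linearity into [J psi = g *: h + J v] with
    [v = K h]. Outside [dom J] only the unsplit equation makes sense, and it defines the bounded
    extension. *)
Lemma resolvent_normal_equation psi h : dom J psi ->
  op_comp (op_inv (op_shift g (op_comp (adjoint ipF ipE K) K))) J (psi, h) <->
  exists v, normal_equation psi h v.
Proof.
have [[[_ Jlin _] _] _ _ _ ->] := JK.
have JD a x y x' y' : J (x, y) -> J (x', y') -> J (a *: x + x', a *: y + y').
  exact: Jlin.
move=> [y0 Jy0]; split.
  move=> [y /= Jy [z [v /= Kv Jz] yE]]; exists v; split=> //.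
  have := JD (-1) _ _ _ _ Jz Jy.
  by rewrite !scaleN1r (addrC _ psi) [y]yE /= addrCA (addrC (- z)) subrr addr0.
(* Here [v] lies in [dom J] as the difference of [psi] and [psi - v], with value [y0 - g *: h]. *)
move=> [v [Kv Jv]]; exists y0 => //=; exists (y0 - g *: h) => /=.
  exists v => //=; have := JD (-1) _ _ _ _ Jv Jy0.
  by rewrite !scaleN1r opprB subrK (addrC _ y0).
by rewrite addrC subrK.
Qed.

(** An abstract copy of [Qfun], convertible to it once the two spaces and their inner products are
    instantiated. *)
Definition tikhonov_functional (psi : E) (h : F) : \bar R :=
  if `[< dom K h >] then
    (sqnorm ipE (psi - opval K h) + g * sqnorm ipF h)%:E
  else +oo%E.

Lemma tikhonov_functionalE psi h v : K (h, v) ->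
  tikhonov_functional psi h = (objective psi h v)%:E.
Proof.
move=> Kh; rewrite /tikhonov_functional /objective (opvalE Kh).
by case: asboolP => // -[]; exists v.
Qed.

Lemma argmin_normal_equation psi h v :
  normal_equation psi h v -> argmin (tikhonov_functional psi) = [set h].
Proof.
move=> Ph; apply/seteqP; split=> [h' /(_ h)|_ -> h'].
  rewrite (tikhonov_functionalE _ Ph.1); rewrite {1}/tikhonov_functional.
  (* A minimizer must lie in the domain of [K], since the value at [h] is finite. *)
  case: asboolP => [[v' Kh']|_]; last by rewrite leye_eq.
  rewrite (opvalE Kh') lee_fin => le.
  have := objectiveE Ph Kh'; rewrite /objective in le * => e.
  have hh := sqnorm_ge0 ipFP (h' - h); have := sqnorm_ge0 ipEP (v' - v) => ?.
  have : g * sqnorm ipF (h' - h) = 0.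
    by have := mulr_ge0 (ltW g0) hh; lra.
  move=> /eqP; rewrite mulf_eq0 (gt_eqF g0) /= => /eqP/(sqnorm_eq0 ipFP)/eqP.
  by rewrite subr_eq0 => /eqP.
rewrite (tikhonov_functionalE _ Ph.1).
have [[v' Kh']|nK] := pselect (dom K h').
  rewrite (tikhonov_functionalE _ Kh') lee_fin (objectiveE Ph Kh') -addrA lerDl.
  by rewrite addr_ge0 ?(sqnorm_ge0 ipEP)// mulr_ge0 ?(sqnorm_ge0 ipFP) ?ltW.
by rewrite /tikhonov_functional asboolF// leey.
Qed.

Lemma tikhonov : exists B : E -> F,
  [/\ bounded_operator ipE ipF B,
      op_comp (op_inv (op_shift g (op_comp (adjoint ipF ipE K) K))) J =
        restriction B (dom J)
    & forall psi, argmin (tikhonov_functional psi) = [set B psi]].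
Proof.
(* [B] selects a solution for each [psi]; uniqueness makes the selection linear and identifies it
   with the resolvent expression on [dom J]. *)
have /choice[B BP] := normal_equation_ex.
exists B; split.
- split=> [a x y|].
    have [[[v1 P1] [v2 P2]] [v3 P3]] := (BP x, BP y, BP (a *: x + y)).
    exact: normal_equation_uniq (normal_equation_linear a P1 P2) P3.
  by exists g^-1 => x; have [v /normal_equation_bound] := BP x.
- apply/seteqP; split=> -[psi h].
    move=> Th; have Jpsi : dom J psi by case: Th => y Jy _; exists y.
    split=> //=; have [v Ph] := (resolvent_normal_equation h Jpsi).1 Th.
    by have [v' Ph'] := BP psi; exact: normal_equation_uniq Ph' Ph.
  by move=> [/= Jpsi ->]; apply/resolvent_normal_equation.
- by move=> psi; have [v] := BP psi; exact: argmin_normal_equation.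
Qed.

End Tikhonov.

(** * Completeness of L2 *)

Section SquareIntegrable.
Context (R : realType) (d : measure_display) (T : measurableType d).
Context (m : {measure set T -> \bar R}).
Implicit Types f g h : T -> R.
Local Notation Lf f := ((f : T -> R) \in Lfun m 2%:E).

(** Stated for functions and an arbitrary measure, so that it serves both [L2 mu] and gradients,
    which are square integrable for [rho]. *)
Definition square_ip f g : R := \int[m]_x (f x * g x).

Lemma Lfun2_measurable f : Lf f -> measurable_fun [set: T] f.
Proof. by move=> /sub_Lfun_mfun; rewrite inE. Qed.

Lemma measurable_sqr_EFin f : measurable_fun [set: T] f ->
  measurable_fun [set: T] (fun x => (f x ^+ 2)%:E).
Proof. by move=> mf; apply/measurable_EFinP; exact: measurable_funX. Qed.

Lemma Lfun2P f : Lf f <-> measurable_fun [set: T] f /\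
  (\int[m]_x (f x ^+ 2)%:E < +oo)%E.
Proof.
split=> [lf|[mf lf]].
  split; first exact: Lfun2_measurable.
  have /integrableP[_] := Lfun2_integrable_sqr lf.
  by under eq_integral do rewrite /= ger0_norm ?sqr_ge0//.
rewrite inE; apply/andP; split; rewrite inE //= /finite_norm unlock /=.
apply: poweR_lty; apply: le_lt_trans lf.
by under eq_integral do rewrite /= powR_mulrn// real_normK ?num_real//.
Qed.

Lemma Lfun2DZ (a : R) f g : Lf f -> Lf g -> Lf (fun x => a * f x + g x).
Proof. by have [_] := Lfun_submod_closed m (lee1n 2) => /(_ a f g). Qed.

Lemma Lfun2B f g : Lf f -> Lf g -> Lf (f \- g).
Proof.
move=> lf lg; rewrite (_ : f \- g = fun x => -1 * g x + f x).
  exact: Lfun2DZ.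
by apply/funext => x /=; rewrite mulN1r addrC.
Qed.

Lemma mul_integrable f g : Lf f -> Lf g ->
  m.-integrable [set: T] (EFin \o (fun x => f x * g x)).
Proof. by move=> lf lg; apply/Lfun1_integrable; exact: Lfun2_mul_Lfun1. Qed.

Lemma square_ipDZl a f g h : Lf f -> Lf g -> Lf h ->
  square_ip (fun x => a * f x + g x) h = a * square_ip f h + square_ip g h.
Proof.
move=> lf lg lh; rewrite /square_ip.
have fh := mul_integrable lf lh; have gh := mul_integrable lg lh.
rewrite -RintegralZl// -RintegralD//; last first.
  have -> : EFin \o (fun x => a * (f x * h x)) =
      (fun x => (a%:E * (EFin \o (fun x => (f x * h x)%R)) x)%E).
    by apply/funext => x /=; rewrite EFinM.
  exact: integrableZl.
by apply: eq_Rintegral => x _; rewrite mulrDl mulrA.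
Qed.

Lemma square_ipE f : Lf f -> (square_ip f f)%:E = (\int[m]_x (f x ^+ 2)%:E)%E.
Proof.
move=> /Lfun2P[_ lf]; rewrite /square_ip /Rintegral fineK// ge0_fin_numE//.
by apply: integral_ge0 => x _; rewrite lee_fin sqr_ge0.
Qed.

Lemma square_ip_ge0 f : 0 <= square_ip f f.
Proof. by apply: Rintegral_ge0 => x _; rewrite -expr2 sqr_ge0. Qed.

Lemma square_ip_eq0 f : Lf f -> square_ip f f = 0 -> {ae m, forall x, f x = 0}.
Proof.
move=> lf f0; have mf := measurable_sqr_EFin (Lfun2_measurable lf).
have /ae_eq_integral_abs : (\int[m]_x `|(f x ^+ 2)%:E| = 0)%E.
  under eq_integral do rewrite /= ger0_norm ?sqr_ge0//.
  by rewrite -square_ipE// f0.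
move=> /(_ measurableT mf); apply: filterS => x /(_ I) /= [/eqP].
by rewrite sqrf_eq0 => /eqP.
Qed.

Lemma eq_square_ip f f' g g' :
  measurable_fun [set: T] f -> measurable_fun [set: T] f' ->
  measurable_fun [set: T] g -> measurable_fun [set: T] g' ->
  {ae m, forall x, f x = f' x} -> {ae m, forall x, g x = g' x} ->
  square_ip f g = square_ip f' g'.
Proof.
move=> mf mf' mg mg' ff' gg'; rewrite /square_ip /Rintegral; congr fine.
apply: ae_eq_integral => //; [by apply/measurable_EFinP; exact: measurable_funM..|].
by apply: filterS2 ff' gg' => x -> ->.
Qed.

Lemma limn_einf_le (u : nat -> \bar R) (N : nat) (e : \bar R) :
  (forall n, (N <= n)%N -> (u n <= e)%E) -> (limn_einf u <= e)%E.
Proof.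
move=> ue; rewrite limn_einf_lim; apply: lime_le; first exact: is_cvg_einfs.
near=> n; apply: (@le_trans _ _ (u n)); last by apply: ue; near: n; exact: nbhs_infty_ge.
by apply: ereal_inf_lbound; exists n => /=.
Unshelve. all: by end_near. Qed.

Lemma sum_half_powers_le n : \sum_(0 <= i < n) (2^-1 : R) ^+ i <= 2.
Proof.
suff : \sum_(0 <= i < n) (2^-1 : R) ^+ i <= 2 - 2 * 2^-1 ^+ n.
  by move=> /le_trans; apply; rewrite gerBl mulr_ge0// exprn_ge0.
elim: n => [|n IH]; first by rewrite big_nil expr0 mulr1 subrr.
rewrite big_nat_recr//= exprS; move: (_ ^+ n) (\sum_(_ <= _ < _) _) IH => *.
by lra.
Qed.

(** The telescoping series converges absolutely: the weights [2 ^+ k] trade control of squared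
    increments for control of their absolute values. *)
Lemma cvg_of_summable_increments (v : nat -> R) (M : R) :
  (forall n, \sum_(0 <= k < n) 2 ^+ k * (v k.+1 - v k) ^+ 2 <= M) ->
  cvgn v.
Proof.
move=> vM.
have -> : v = (fun n => v 0%N + series (telescope v) n).
  by apply/funext => n; rewrite -eq_sum_telescope.
apply: is_cvgD; first exact: is_cvg_cst.
apply: normed_cvg; apply: nondecreasing_is_cvgn.
  by apply: nondecreasing_series => n _ _; exact: normr_ge0.
exists (2 + M) => _ [n _ <-].
(* AM-GM: [2 |x| <= 2^-i + 2^i x^2] *)
apply: (@le_trans _ _ (\sum_(0 <= i < n) ((2^-1 : R) ^+ i +
    2 ^+ i * (v i.+1 - v i) ^+ 2))).
  apply: ler_sum => i _; rewrite /telescope /= -(real_normK (num_real (_ - _))).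
  set x := `|_|.
  have x0 : 0 <= x by exact: normr_ge0.
  have p0 : 0 < (2 : R) ^+ i by rewrite exprn_gt0.
  have : 0 <= (2 ^+ i * x - 1) ^+ 2 / 2 ^+ i by rewrite divr_ge0 ?sqr_ge0 ?ltW.
  have -> : (2 ^+ i * x - 1) ^+ 2 / 2 ^+ i =
      2 ^+ i * x ^+ 2 - 2 * x + (2 ^+ i)^-1 by field; rewrite gt_eqF.
  by rewrite exprVn; move: (_^-1) (_ * x ^+ 2) => *; lra.
by rewrite big_split /= lerD// sum_half_powers_le.
Qed.

(** The weighted squared increments have integrals at most [2 ^+ k * 4^-1 ^+ k = 2^-1 ^+ k], so
    their sum is integrable and hence finite almost everywhere. *)
Lemma ae_cvg_of_fast_cauchy (v : nat -> T -> R) :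
  (forall k, Lf (v k)) ->
  (forall k, square_ip (v k.+1 \- v k) (v k.+1 \- v k) <= 4^-1 ^+ k) ->
  {ae m, forall x, cvgn (v ^~ x)}.
Proof.
move=> lv vk; pose t k x := 2 ^+ k * (v k.+1 x - v k x) ^+ 2 : R.
have t0 k x : 0 <= t k x by rewrite mulr_ge0 ?sqr_ge0// exprn_ge0.
have mv k := Lfun2_measurable (lv k).
have mt k : measurable_fun [set: T] (EFin \o t k).
  apply/measurable_EFinP; apply: measurable_funM => //.
  by apply: measurable_funX; exact: measurable_funB.
have ti k : (\int[m]_x (t k x)%:E <= (2^-1 ^+ k)%:E)%E.
  under eq_integral do rewrite EFinM.
  rewrite ge0_integralZl//; last 2 first.
  - by apply: measurable_sqr_EFin; exact: measurable_funB.
  - by move=> x _; rewrite lee_fin sqr_ge0.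
  rewrite -(square_ipE (Lfun2B (lv k.+1) (lv k))) -EFinM lee_fin.
  apply: (@le_trans _ _ (2 ^+ k * 4^-1 ^+ k)).
    by rewrite ler_wpM2l// exprn_ge0.
  by rewrite -exprMn (_ : 2 * 4^-1 = 2^-1)//; lra.
have si : (\int[m]_x (\sum_(k <oo) (t k x)%:E) < +oo)%E.
  rewrite integral_nneseries//; last by move=> n x _; rewrite lee_fin t0.
  apply: (@le_lt_trans _ _ (\sum_(k <oo) (2^-1 ^+ k : R)%:E)%E).
    apply: lee_nneseries => [k _ _|k _]; last exact: ti.
    by apply: integral_ge0 => x _; rewrite lee_fin.
  apply: (@le_lt_trans _ _ 2%:E); last exact: ltry.
  apply: lime_le; first by apply: is_cvg_nneseries => k _ _; rewrite lee_fin exprn_ge0.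
  by apply: nearW => n; rewrite sumEFin lee_fin sum_half_powers_le.
have /integrable_ae : m.-integrable [set: T] (fun x => \sum_(k <oo) (t k x)%:E)%E.
  apply/integrableP; split.
    apply: ge0_emeasurable_sum => [k x _ _|k _]; last exact: mt.
    by rewrite lee_fin t0.
  rewrite (eq_integral (fun x => \sum_(k <oo) (t k x)%:E)%E)// => x _.
  by rewrite gee0_abs// nneseries_ge0// => n _ _; rewrite lee_fin t0.
move=> /(_ measurableT); apply: filterS => x /(_ I) xfin.
apply: (@cvg_of_summable_increments _ (fine (\sum_(k <oo) (t k x)%:E)%E)) => n.
rewrite -lee_fin fineK// -sumEFin.
by apply: nneseries_lim_ge => k _ _; rewrite lee_fin; exact: t0.
Qed.

(** A fast subsequence converges almost everywhere, and Fatou's lemma turns its pointwise limit into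
    a norm limit of the whole sequence. *)
Lemma riesz_fischer (u : nat -> T -> R) : (forall n, Lf (u n)) ->
  (forall e : R, 0 < e -> exists N, forall i j, (N <= i)%N -> (N <= j)%N ->
     square_ip (u i \- u j) (u i \- u j) < e) ->
  exists2 f, Lf f & (fun n => square_ip (u n \- f) (u n \- f)) @ \oo --> (0 : R).
Proof.
move=> lu cu.
have /choice[phi phiP] (k : nat) : exists N, forall i j,
    (N <= i)%N -> (N <= j)%N ->
    square_ip (u i \- u j) (u i \- u j) < 4^-1 ^+ k.
  by apply: cu; rewrite exprn_gt0.
(* Summing the successors gives indices that strictly increase and still dominate [phi]. *)
pose psi k := (\sum_(i < k.+1) (phi i).+1)%N.
have psiS k : psi k.+1 = (psi k + (phi k.+1).+1)%N by rewrite /psi big_ord_recr.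
have psi_ge k : (phi k <= psi k)%N.
  by rewrite /psi big_ord_recr /= (leq_trans (leqnSn _))// leq_addl.
have psi_id k : (k <= psi k)%N.
  elim: k => // k IH; apply: (leq_trans (n := (psi k).+1)) => //.
  by rewrite psiS addnS ltnS leq_addr.
have fast k : square_ip (u (psi k.+1) \- u (psi k)) (u (psi k.+1) \- u (psi k)) <=
    4^-1 ^+ k.
  apply/ltW/phiP; last exact: psi_ge.
  by rewrite psiS (leq_trans (psi_ge k))// leq_addr.
have [N [mN N0 NP]] := @ae_cvg_of_fast_cauchy (u \o psi) (fun k => lu _) fast.
(* Setting the subsequence to 0 on the exceptional null set makes it converge everywhere, so the
   limit is measurable. *)
pose w k x := u (psi k) x * \1_(~` N) x : R.
have mu n := Lfun2_measurable (lu n).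
have mw k : measurable_fun [set: T] (w k).
  by apply: measurable_funM => //; apply: measurable_indic; exact: measurableC.
pose f x := limn (w ^~ x).
have wf x : w ^~ x @ \oo --> f x.
  have [Nx|nNx] := pselect (N x).
    have wE : w ^~ x = fun=> 0.
      by apply/funext => k; rewrite /w indicE in_setC mem_set// mulr0.
    by rewrite /f wE; exact: is_cvg_cst.
  have wE : w ^~ x = (u \o psi) ^~ x.
    by apply/funext => k; rewrite /w indicE in_setC memNset// mulr1.
  by rewrite /f wE; apply: contrapT => h; apply: nNx; apply: NP.
have mf : measurable_fun [set: T] f.
  by apply: (measurable_fun_cvg mw) => x _; exact: wf.
(* Fatou in [k] with [n] fixed: a bound on the distances from [u n] to all later terms passes to
   [f]. *)
have bound n i (e : R) : (forall j, (i <= j)%N ->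
      square_ip (u n \- u j) (u n \- u j) <= e) ->
    (\int[m]_x ((u n x - f x) ^+ 2)%:E <= e%:E)%E.
  move=> ue.
  have -> : (\int[m]_x ((u n x - f x) ^+ 2)%:E)%E =
      (\int[m]_x limn_einf (fun k => ((u n x - w k x) ^+ 2)%:E))%E.
    apply: eq_integral => x _; apply/esym.
    have h : (fun k => ((u n x - w k x) ^+ 2)%:E) @ \oo --> ((u n x - f x) ^+ 2)%:E.
      apply: cvg_EFin; first by apply: nearW.
      have h : (fun k => u n x - w k x) @ \oo --> u n x - f x.
        by apply: cvgB => //; exact: cvg_cst.
      by under eq_fun do rewrite expr2; rewrite expr2; exact: cvgM.
    by rewrite (cvg_limn_einf_sup h).1.
  apply: le_trans (fatou _ _ _ _) _ => //.
  - by move=> k; apply: measurable_sqr_EFin; exact: measurable_funB.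
  - by move=> k x _; rewrite lee_fin sqr_ge0.
  apply: (@limn_einf_le _ i) => k ik.
  have := ue (psi k) (leq_trans ik (psi_id k)); rewrite -lee_fin.
  rewrite square_ipE; last exact: Lfun2B.
  apply: le_trans; rewrite le_eqVlt; apply/orP; left; apply/eqP.
  apply: ge0_ae_eq_integral => //.
  - by apply: measurable_sqr_EFin; exact: measurable_funB.
  - by apply: measurable_sqr_EFin; exact: measurable_funB.
  - by move=> x _; rewrite lee_fin sqr_ge0.
  - by move=> x _; rewrite lee_fin sqr_ge0.
  exists N; split => // x /= h; apply: contrapT => nNx; apply: h => _.
  by rewrite /w indicE in_setC memNset// mulr1.
have luf n i e : (forall j, (i <= j)%N ->
      square_ip (u n \- u j) (u n \- u j) <= e) -> Lf (u n \- f).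
  move=> /bound h; apply/Lfun2P; split; first exact: measurable_funB.
  exact: le_lt_trans h (ltry _).
have lf : Lf f.
  have [N1 N1P] := cu 1 ltr01.
  have -> : f = u N1 \- (u N1 \- f) by apply/funext => x /=; rewrite subKr.
  apply: Lfun2B => //; apply: (@luf N1 N1 1) => j Nj.
  by apply/ltW/N1P.
exists f => //; apply/cvgrPdist_le => e e0.
have [N1 N1P] := cu e e0; exists N1 => // n Nn /=.
rewrite sub0r normrN ger0_norm ?square_ip_ge0//.
rewrite -lee_fin square_ipE; last exact: Lfun2B.
by apply: (bound n N1) => j Nj; apply/ltW/N1P.
Qed.

End SquareIntegrable.

(** * Quotient classes and the Hilbert space L2 *)

Section QuotientClasses.
Context (K : pzRingType) (M : lmodType K) (I : submodClosed M).

Lemma lclass0 : lclass I 0 = 0.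
Proof. by apply: (addrI (lclass I 0)); rewrite -lclassD !addr0. Qed.

Lemma lclassDZ a x y : lclass I (a *: x + y) = a *: lclass I x + lclass I y.
Proof. by rewrite lclassD lclassZ. Qed.

Lemma lclassB x y : lclass I (x - y) = lclass I x - lclass I y.
Proof. by rewrite -!(addrC (- y)) -!(addrC (- lclass I y)) -!scaleN1r lclassDZ. Qed.

End QuotientClasses.

Section L2Hilbert.
Context (R : realType) (d : measure_display) (V : measurableType d).
Context (mu : {measure set V -> \bar R}).

(** [L2ip] is computed on chosen representatives; this allows replacing them by any others. *)
Lemma lrepr_L2class (f : L2fun mu) :
  {ae mu, forall x, (lrepr (L2class f) : L2fun mu) x = f x}.
Proof.
have /lclass_eq : lclass (@ae_zero _ _ _ mu) (lrepr (L2class f)) = L2class f.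
  by rewrite lreprK.
rewrite inE /=; apply: filterS => x /eqP; rewrite subr_eq0 => /eqP.
exact.
Qed.

Lemma L2_measurable (f : L2fun mu) : measurable_fun [set: V] f.
Proof. exact: Lfun2_measurable (LfunP f). Qed.

Lemma L2ip_class (f g : L2fun mu) :
  L2ip mu (L2class f) (L2class g) = square_ip mu f g.
Proof.
apply: eq_square_ip; try exact: L2_measurable; exact: lrepr_L2class.
Qed.

Lemma L2_surj (u : L2 mu) : exists f : L2fun mu, u = L2class f.
Proof. by exists (lrepr u); rewrite /L2class lreprK. Qed.

Lemma L2ip_inner_product : inner_product (L2ip mu).
Proof.
split.
- by move=> x y; apply: eq_Rintegral => v _; rewrite mulrC.
- move=> a x y z; have [f ->] := L2_surj x; have [g ->] := L2_surj y.
  have [h ->] := L2_surj z.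
  rewrite -[_ *: _ + _](lclassDZ (@ae_zero _ _ _ mu)).
  by rewrite !L2ip_class -square_ipDZl//; exact: LfunP.
- by move=> x; exact: square_ip_ge0.
- move=> x; have [f ->] := L2_surj x; rewrite L2ip_class.
  move=> /(square_ip_eq0 (LfunP f)) f0.
  have <- : L2class (0 : L2fun mu) = 0 by exact: lclass0.
  apply/lclass_eq; rewrite subr0 inE; exact: f0.
Qed.

Lemma L2_complete : cauchy_complete (L2ip mu).
Proof.
move=> u cu.
have uE (f g : L2fun mu) : sqnorm (L2ip mu) (L2class f - L2class g) =
    square_ip mu (f \- g) (f \- g).
  by rewrite /sqnorm -[_ - _](lclassB (@ae_zero _ _ _ mu)) L2ip_class.
have ul n : u n = L2class (lrepr (u n)) by rewrite /L2class lreprK.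
have [n|e e0|f lf uf] := @riesz_fischer _ _ _ mu (fun n => lrepr (u n) : L2fun mu).
- exact: LfunP.
- by have [N NP] := cu e e0; exists N => i j Ni Nj; rewrite -uE -!ul; exact: NP.
pose F : L2fun mu := Lfun_Sub (lee1n 2) lf.
exists (L2class F); under eq_fun do rewrite ul uE.
exact: uf.
Qed.

End L2Hilbert.

(** * Definiteness of the energy form *)

Section AlmostEverywhere.
Context (R : realType) (d : measure_display) (V : measurableType d).
Context (mu : {measure set V -> \bar R}).

Lemma ae_measure0 (A : set V) : measurable A ->
  {ae mu, forall x, ~ A x} <-> mu A = 0.
Proof.
move=> mA; rewrite -negligibleP//.
split=> h; last by apply: negligibleS h => x /= /contrapT.
by apply: negligibleS h => x Ax /=; apply.
Qed.

(** The constant is the supremum of the levels [c] that [f] reaches almost everywhere. *)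
Lemma ae_const_of_dichotomy (f : V -> R) :
  (forall c, {ae mu, forall x, c <= f x} \/ {ae mu, forall x, f x < c}) ->
  exists c, {ae mu, forall x, f x = c}.
Proof.
move=> dich.
(* For the zero measure any constant works. Otherwise an almost everywhere contradiction is absurd,
   which makes the set of levels nonempty and bounded above. *)
have [mu0|mu0] := pselect {ae mu, forall x : V, False}.
  by exists 0; apply: filterS mu0.
pose S := [set c | {ae mu, forall x, c <= f x}].
have S0 : S !=set0.
  apply: contrapT => nS; apply: mu0.
  have : {ae mu, forall x, forall n : nat, f x < - n%:R}.
    apply: ae_foralln => n; have [h|//] := dich (- n%:R).
    by exfalso; apply: nS; exists (- n%:R).
  apply: filterS => x /(_ (Num.bound `|f x|)).
  rewrite ltrNr; apply/negP; rewrite -leNgt.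
  apply: le_trans (ltW (archi_boundP (normr_ge0 (f x)))).
  by rewrite -normrN ler_norm.
have [b Qb] : exists b, {ae mu, forall x, f x < b}.
  apply: contrapT => nQ; apply: mu0.
  have : {ae mu, forall x, forall n : nat, n%:R <= f x}.
    apply: ae_foralln => n; have [//|h] := dich n%:R.
    by exfalso; apply: nQ; exists n%:R.
  apply: filterS => x /(_ (Num.bound `|f x|)).
  apply/negP; rewrite -ltNge.
  exact: le_lt_trans (ler_norm _) (archi_boundP (normr_ge0 _)).
have hS : has_sup S.
  split=> //; exists b => c Sc; rewrite leNgt; apply/negP => bc; apply: mu0.
  apply: filterS2 Sc Qb => x cf fb.
  by have := lt_trans (le_lt_trans cf fb) bc; rewrite ltxx.
exists (sup S).
(* Only countably many levels are tested, so the exceptional sets have a null union. *)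
have lo : {ae mu, forall x, forall k : nat, sup S - harmonic k <= f x}.
  apply: ae_foralln => k.
  have [c Sc ck] := sup_adherent (harmonic_gt0 k) hS.
  by apply: filterS Sc => x; apply: le_trans (ltW ck).
have hi : {ae mu, forall x, forall k : nat, f x < sup S + harmonic k}.
  apply: ae_foralln => k; have [Sk|//] := dich (sup S + harmonic k).
  have := sup_upper_bound hS Sk.
  by rewrite gerDl leNgt harmonic_gt0.
apply: filterS2 lo hi => x lox hix.
have h (y : R) : (forall k, y <= harmonic k) -> y <= 0.
  by move=> yk; exact: (le0_of_cvg0 yk cvg_harmonic).
apply/eqP; rewrite eq_le -subr_le0 -(subr_le0 (f x) (sup S)).
by apply/andP; split; apply: h => k; [have := hix k|have := lox k]; lra.
Qed.

End AlmostEverywhere.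

(** * Null sets, irreducibility and the energy inner product *)

Section EnergyHilbert.
Context (R : realType) (d : measure_display) (V : measurableType d).
Context (mu : {measure set V -> \bar R}) (rho : {measure set (V * V) -> \bar R}).
Context (rhox : R.-ker V ~> V).
Context (rho_sym : symmetric_measure rho).
Context (rho_disint : disintegration mu rho rhox).

Lemma rectangle_measure (A B : set V) : measurable A -> measurable B ->
  rho (A `*` B) = (\int[mu]_x ((\1_A x)%:E * rhox x B))%E.
Proof.
move=> mA mB; have mAB : measurable (A `*` B) by exact: measurableX.
rewrite -{1}[A `*` B]setIT -integral_indic// rho_disint; last 2 first.
- by apply/measurable_EFinP; exact: measurable_indic.
- by move=> p; rewrite lee_fin.
apply: eq_integral => x _.
under eq_integral => y _ do rewrite indicE in_setX /= -mulnb natrM EFinM -!indicE.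
rewrite ge0_integralZl ?integral_indic ?setIT//.
by apply/measurable_EFinP; exact: measurable_indic.
Qed.

Lemma measurable_rectangle_density (A B : set V) : measurable A -> measurable B ->
  measurable_fun [set: V] (fun x => (\1_A x)%:E * rhox x B)%E.
Proof.
move=> mA mB; apply: emeasurable_funM; last exact: measurable_kernel.
by apply/measurable_EFinP; exact: measurable_indic.
Qed.

Lemma rectangle_null (A B : set V) : measurable A -> measurable B ->
  rho (A `*` B) = 0 -> {ae mu, forall x, A x -> rhox x B = 0}.
Proof.
move=> mA mB; rewrite rectangle_measure// => i0.
have /ae_eq_integral_abs : (\int[mu]_x `|(\1_A x)%:E * rhox x B| = 0)%E.
  by under eq_integral do rewrite gee0_abs ?mule_ge0 ?lee_fin//.
move=> /(_ measurableT (measurable_rectangle_density mA mB)).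
by apply: filterS => x /(_ I) /= + Ax; rewrite indicE mem_set// mul1e.
Qed.

(** The disintegration handles the first coordinate and symmetry of [rho] the second. Hence changing
    a function on a [mu]-null set changes its gradient only on a [rho]-null set. *)
Lemma cylinder_null (N : set V) : measurable N -> mu N = 0 ->
  rho (N `*` setT) = 0 /\ rho (setT `*` N) = 0.
Proof.
move=> mN N0.
suff h : rho (N `*` setT) = 0 by split=> //; rewrite rho_sym.
rewrite rectangle_measure//.
rewrite -[RHS](integral0 mu setT); apply: ae_eq_integral => //.
  exact: measurable_rectangle_density.
move/(ae_measure0 _ mN): N0; apply: filterS => x nNx _.
by rewrite indicE memNset// mul0e.
Qed.

Lemma ae_ae_prod (P : set V) : {ae mu, forall x, P x} ->
  {ae rho, forall p, P p.1 /\ P p.2}.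
Proof.
move=> [N [mN N0 PN]]; have [h1 h2] := cylinder_null mN N0.
move: h1 h2 => /(ae_measure0 _ (measurableX mN measurableT)) h1.
move=> /(ae_measure0 _ (measurableX measurableT mN)).
apply: filterS2 h1 => p nN1 nN2.
by split; apply: contrapT => /PN; [move=> N1; apply: nN1|move=> N2; apply: nN2].
Qed.

Lemma kernel_pow_ge0 n x (B : set V) : (0 <= kernel_pow rhox n x B)%E.
Proof. by elim: n x => [|n IH] x //=; apply: integral_ge0. Qed.

Lemma measurable_kernel_pow n (B : set V) : measurable B ->
  measurable_fun [set: V] (fun x => kernel_pow rhox n x B).
Proof.
move=> mB; elim: n => [|n IH] /=; first exact: measurable_kernel.
apply: (@measurable_fun_integral_kernel _ _ _ _ R rhox) => //.
- by move=> U mU; exact: measurable_kernel.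
- by move=> z; exact: kernel_pow_ge0.
Qed.

(** Induction on [n]: from almost every point outside [B] one step avoids both [B] and the null set
    where the induction hypothesis fails, and the remaining steps contribute 0. *)
Lemma kernel_pow_null (B : set V) n : measurable B -> rho (~` B `*` B) = 0 ->
  {ae mu, forall x, ~ B x -> kernel_pow rhox n x B = 0}.
Proof.
move=> mB r0; have mA := measurableC mB.
have BP := rectangle_null mA mB r0.
elim: n => [//|n [N [mN N0 NP]]].
have := rectangle_null measurableT mN (cylinder_null mN N0).2.
apply: filterS2 BP => x xB xN nBx /=; have {}xB := xB nBx; have {}xN := xN I.
rewrite -[RHS](integral0 (rhox x) setT); apply: ae_eq_integral => //.
  exact: measurable_kernel_pow.
move: xB xN => /(ae_measure0 _ mB) xB /(ae_measure0 _ mN).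
apply: filterS2 xB => y nBy nNy _.
by apply: contrapT => h; apply/nNy/NP => /= /(_ nBy).
Qed.

Context (rho_irr : irreducible_kernel mu rhox).

(** If [B] has positive measure, irreducibility makes some kernel power charge it from almost every
    point; by [kernel_pow_null] such points lie in [B]. *)
Lemma irreducible_dichotomy (B : set V) : measurable B ->
  rho (~` B `*` B) = 0 ->
  {ae mu, forall x, B x} \/ {ae mu, forall x, ~ B x}.
Proof.
move=> mB r0; have [B0|] := eqVneq (mu B) 0; first by right; apply/ae_measure0.
rewrite -measure_gt0 => /(rho_irr mB) irr; left.
have := ae_foralln (fun n => kernel_pow_null n mB r0).
apply: filterS2 irr => x [n kn] k0; apply: contrapT => nBx.
by move: kn; rewrite k0// ltxx.
Qed.

Lemma ae_const_of_gradient0 (f : V -> R) : measurable_fun [set: V] f ->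
  {ae rho, forall p, f p.1 - f p.2 = 0} -> exists c, {ae mu, forall x, f x = c}.
Proof.
move=> mf f0; apply: ae_const_of_dichotomy => c.
pose B := [set x | c <= f x].
have mB : measurable B by rewrite -[B]setTI; exact: measurable_fun_le.
have [|h|h] := @irreducible_dichotomy B mB; last 2 first.
- by left.
- by right; apply: filterS h => x /= /negP; rewrite -ltNge.
apply/ae_measure0; first by apply: measurableX => //; exact: measurableC.
apply: filterS f0 => p /eqP; rewrite subr_eq0 => /eqP e [] /=.
by rewrite /B /= e.
Qed.

(** Up to the factor 1/2 this embeds the energy space isometrically into the square integrable
    functions for [rho], where the lemmas on [square_ip] apply. *)
Definition gradient (f : V -> R) (p : V * V) : R := f p.1 - f p.2.

Lemma energy_fun_measurable (f : energy_fun rho) : measurable_fun [set: V] f.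
Proof. by have := energy_funP f; rewrite inE => -[]. Qed.

Lemma gradient_Lfun2 (f : energy_fun rho) : gradient f \in Lfun rho 2%:E.
Proof.
have mf := energy_fun_measurable f.
apply/Lfun2P; split.
  by apply: measurable_funB;
    [exact: (measurableT_comp mf measurable_fst)
    |exact: (measurableT_comp mf measurable_snd)].
have := energy_funP f; rewrite inE => -[_]; rewrite /energy.
have : (0 <= \int[rho]_p ((f p.1 - f p.2) ^+ 2)%:E)%E.
  by apply: integral_ge0 => p _; rewrite lee_fin sqr_ge0.
rewrite /gradient; case: (integral _ _ _) => [r||] //= _; first by move=> _; exact: ltry.
by rewrite gt0_muley ?lte_fin ?invr_gt0.
Qed.

(** Two representatives differ by a constant [mu]-almost everywhere, and the constant cancels in the
    difference of the two coordinates. *)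
Lemma lrepr_HEclass (f : energy_fun rho) :
  {ae rho, forall p, gradient (lrepr (HEclass mu f) : energy_fun rho) p = gradient f p}.
Proof.
have /lclass_eq : lclass (@ae_const _ _ _ mu rho) (lrepr (HEclass mu f)) = HEclass mu f.
  by rewrite lreprK.
rewrite inE /= => -[c /ae_ae_prod].
apply: filterS => p []; rewrite /gradient.
set g := lrepr _ : energy_fun rho => e1 e2.
have {}e1 : g p.1 - f p.1 = c := e1.
have {}e2 : g p.2 - f p.2 = c := e2.
by lra.
Qed.

Lemma HEip_class (f g : energy_fun rho) :
  HEip mu rho (HEclass mu f) (HEclass mu g) =
    2^-1 * square_ip rho (gradient f) (gradient g).
Proof.
congr (_ * _).
by apply: eq_square_ip; try exact: (Lfun2_measurable (gradient_Lfun2 _));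
  exact: lrepr_HEclass.
Qed.

Lemma HE_surj (u : HE mu rho) : exists f : energy_fun rho, u = HEclass mu f.
Proof. by exists (lrepr u); rewrite /HEclass lreprK. Qed.

Lemma HEip_inner_product : inner_product (HEip mu rho).
Proof.
split.
- move=> x y; congr (_ * _); apply: eq_Rintegral => v _; exact: mulrC.
- move=> a x y z; have [f ->] := HE_surj x; have [g ->] := HE_surj y.
  have [h ->] := HE_surj z.
  rewrite -[_ *: _ + _](lclassDZ (@ae_const _ _ _ mu rho)) !HEip_class.
  rewrite mulrCA -mulrDr -square_ipDZl; try exact: gradient_Lfun2.
  congr (_ * square_ip _ _ _); apply/funext => p; rewrite /gradient.
  by rewrite -[LHS]/((a * f p.1 + g p.1) - (a * f p.2 + g p.2)); ring.
- by move=> x; rewrite mulr_ge0// square_ip_ge0.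
- move=> x; have [f ->] := HE_surj x; rewrite HEip_class => /eqP.
  rewrite mulf_eq0 invr_eq0 pnatr_eq0 /= => /eqP.
  move=> /(square_ip_eq0 (gradient_Lfun2 f)).
  move=> /(ae_const_of_gradient0 (energy_fun_measurable f)) fc.
  have <- : HEclass mu (0 : energy_fun rho) = 0 by exact: lclass0.
  by apply/lclass_eq; rewrite subr0 inE.
Qed.

End EnergyHilbert.

Theorem proposition7p10
  (R : realType) (d : measure_display) (V : measurableType d)
  (mu : {measure set V -> \bar R})
  (rho : {measure set (V * V) -> \bar R})
  (rhox : R.-ker V ~> V)
  (V_borel : standard_borel R V)
  (V_uncountable : ~ countable [set: V])
  (mu_sfin : sigma_finite [set: V] mu)
  (mu_nonatomic : non_atomic mu)
  (rho_sfin : sigma_finite [set: V * V] rho)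
  (rho_sym : symmetric_measure rho)
  (rho_disint : disintegration mu rho rhox)
  (c_fin : {ae mu, forall x, (0 < total_conductance rhox x < +oo)%E})
  (c_loc : forall A, measurable A -> (mu A < +oo)%E ->
     (\int[mu]_(x in A) total_conductance rhox x < +oo)%E)
  (rho_irr : irreducible_kernel mu rhox)
  (HE_complete : cauchy_complete (HEip mu rho))
  (HE_loc : forall f : energy_fun rho, L2_loc mu f)
  (J : set (L2 mu * HE mu rho)) (K : set (HE mu rho * L2 mu))
  (JK_pair : symmetric_pair (L2ip mu) (HEip mu rho) J K)
  (J_span : span_embedding mu rho `<=` J)
  (DeltaE : set (HE mu rho * HE mu rho))
  (DeltaE_sym : symmetric_operator (HEip mu rho) DeltaE)
  (DeltaE_lap : realizes_laplacian rhox DeltaE)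
  (DeltaE_ext :
     DeltaE `<=` op_comp (adjoint (HEip mu rho) (L2ip mu) K) K)
  (gamma : R) (gamma_gt0 : 0 < gamma) :
  let DeltaT := op_comp (adjoint (HEip mu rho) (L2ip mu) K) K in
  exists B : L2 mu -> HE mu rho,
    [/\ bounded_operator (L2ip mu) (HEip mu rho) B,
        op_comp (op_inv (op_shift gamma DeltaT)) J = restriction B (dom J) &
        forall psi : L2 mu, argmin (Qfun gamma K psi) = [set B psi]].
Proof.
move=> DeltaT.
(* Completeness of the energy space is the hypothesis [HE_complete]; its definiteness comes from
   irreducibility. *)
exact: (tikhonov (L2ip_inner_product mu)
  (HEip_inner_product rho_sym rho_disint rho_irr) (@L2_complete _ _ _ mu)
  HE_complete JK_pair gamma_gt0).
Qed.
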